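(* Let $(M^{2n},\theta,\mu)$ be a $(2n,k)$-manifold with $\mu(M^{2n})=P^k$, and write $\mathfrak{E}(M^{2n},P^k)/T^k=\{(x,y)\in CQ(M^{2n},P^k)\times M^{2n}/T^k: x\in P'_\sigma,\ y\in W_\sigma/T^k\text{ for some }\sigma\in\mathfrak{S},\ \widehat\pi(x)=\widehat\mu(y)\}$. Then the map $\widehat{G_2}:\mathfrak{E}(M^{2n},P^k)/T^k\to M^{2n}/T^k$ given by $\widehat{G_2}(x,y)=y$ is a homeomorphism.
   Context: Conventions. $T^k=(S^1)^k$; $\mathring{P}$ is the relative interior of a convex polytope $P$ (a point is its own relative interior); for a subset $Y$ of a topological space, $\bar\partial Y=\overline{Y}\setminus Y$; $[1,m]=\{1,\dots,m\}$. A $(2n,k)$-manifold ($1\le k\le n$) is a triple $(M^{2n},\theta,\mu)$: $M^{2n}$ is a smooth closed oriented $2n$-manifold; $\theta$ is a smooth effective action of $T^k$ on $M^{2n}$ all of whose stabilizers are connected; $\mu:M^{2n}\to\mathbb{R}^k$ (the almost moment map) is a smooth $T^k$-invariant map whose image is a $k$-dimensional convex polytope $P^k$ and which is open as a map onto $P^k$; and Axioms 1-6 hold. Axiom 1. There is a smooth atlas $\{(M_i,\varphi_i)\}$ of $M^{2n}$ with $M_i$ open, $T^k$-invariant and dense, $\varphi_i:M_i\to\mathbb{R}^{2n}$ coordinate homeomorphisms, each $M_i$ containing exactly one $T^k$-fixed point $x_i$, with $\varphi_i(x_i)=0$ and $x_i\ne x_j$ for $i\neq j$. (The atlas is finite,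 indexed by $[1,m]$, $m$ being the number of fixed points.) Put $Y_i=M^{2n}\setminus M_i$, and for $\sigma\subseteq[1,m]$ put $W_\sigma=\bigcap_{i\in\sigma}M_i\cap\bigcap_{i\notin\sigma}Y_i$. If $W_\sigma\ne\emptyset$, it is called a stratum and $\sigma$ is called admissible; $\mathfrak{S}$ is the set of admissible sets. The strata are $T^k$-invariant and partition $M^{2n}$. The main stratum is $W=W_{[1,m]}$. Axiom 2. $\mu$ gives a bijection between the fixed points and the vertices of $P^k$. Put $v_i=\mu(x_i)$; for $\sigma\in\mathfrak{S}$ the admissible polytope is $P_\sigma=\mathrm{conv}\{v_i:i\in\sigma\}$. Axiom 3. The stabilizer is constant on each stratum. Let $T^\sigma$ be the quotient of $T^k$ by the stabilizer of points of $W_\sigma$; it acts freely on $W_\sigma$ and $W_\sigma/T^\sigma=W_\sigma/T^k$. Axiom 4. Let $\widehat\mu:M^{2n}/T^k\to P^k$ be induced by $\mu$. For $\sigma\in\mathfrak{S}$: (a) $\mu(W_\sigma)=\mathring{P_\sigma}$; (b) the restriction $\widehat\mu_\sigma:W_\sigma/T^\sigma\to\mathring{P_\sigma}$ is a fiber bundle; (c) $\dim P_\sigma=\dim T^\sigma$. This bundle is trivial (contractible base); its fiber $F_\sigma$ is the space of parameters of $W_\sigma$, and $F$ is that of the main stratum. A trivialization $h_\sigma:W_\sigma/T^\sigma\to\mathring{P_\sigma}\times F_\sigma$ over $\mathring{P_\sigma}$ is fixed as part of the structure; $\xi_\sigma:W_\sigma/T^\sigma\to F_\sigma$ is its second component.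 For $c\in F_\sigma$ the leaf $W_\sigma[\xi_\sigma,c]\subset W_\sigma$ is the preimage of $\xi_\sigma^{-1}(c)$ under $W_\sigma\to W_\sigma/T^\sigma$. Axiom 5. For every leaf $W_\sigma[\xi_\sigma,c_\sigma]$: (a) it is a smooth submanifold of $M^{2n}$ and $\mu$ restricts to a smooth fiber bundle $W_\sigma[\xi_\sigma,c_\sigma]\to\mathring{P_\sigma}$; (b) $\bar\partial W_\sigma[\xi_\sigma,c_\sigma]$ is the union of leaves $W_{\bar\sigma}[\xi_{\bar\sigma},c_{\bar\sigma}]$, for exactly one $c_{\bar\sigma}\in F_{\bar\sigma}$ for each $\bar\sigma$, where $P_{\bar\sigma}$ runs through some admissible faces of $P_\sigma$; (c) the map $\eta_{\sigma,\bar\sigma}:F_\sigma\to F_{\bar\sigma}$, $c_\sigma\mapsto c_{\bar\sigma}$, given by (b) is continuous. Complexes. $C(M^{2n},P^k)=\bigsqcup_{\sigma\in\mathfrak{S}}P'_\sigma$ is a formal disjoint union of copies $P'_\sigma$ of $\mathring{P_\sigma}$; $\widehat\pi:C(M^{2n},P^k)\to P^k$ is the canonical map, identifying each $P'_\sigma$ with $\mathring{P_\sigma}$. The map $f:M^{2n}\to C(M^{2n},P^k)$ sends $y\in W_\sigma$ to the unique $x\in P'_\sigma$ with $\widehat\pi(x)=\mu(y)$. $CQ(M^{2n},P^k)$ is $C(M^{2n},P^k)$ with the quotient topology of $f$. The space $\mathfrak{E}(M^{2n},P^k)=\{(x,y)\in C(M^{2n},P^k)\times M^{2n}: x\in P'_\sigma,\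 y\in W_\sigma\text{ for some }\sigma\in\mathfrak{S},\ \widehat\pi(x)=\mu(y)\}$ has the topology induced from $CQ(M^{2n},P^k)\times M^{2n}$; $T^k$ acts on it through the second factor, and $\mathfrak{E}(M^{2n},P^k)/T^k$ is the orbit space. Points of $\mathfrak{E}(M^{2n},P^k)/T^k$ can be written as pairs $(x,c)$, $x\in P'_\sigma$, $c\in F_\sigma$, via $h_\sigma$. Axiom 6. There are a topological space $\mathcal{F}$ and, for each $\sigma\in\mathfrak{S}$, a topological space $\tilde F_\sigma$ and a continuous inclusion $I_\sigma:\tilde F_\sigma\to\mathcal{F}$ (write $\tilde F,I$ for $\sigma=[1,m]$ and $\tilde F_i,I_i$ for $\sigma=\{i\}$) such that: (a) $\tilde F=F$ and $\mathcal{F}$ is a compactification of $I(F)$; (b) $I_\sigma(\tilde F_\sigma)\subset I_{\bar\sigma}(\tilde F_{\bar\sigma})$ whenever $P_{\bar\sigma}$ is an admissible face of $P_\sigma$, and $\mathcal{F}=\bigcup_{i=1}^m I_i(\tilde F_i)$; (c) there are continuous projections $p_\sigma:\tilde F_\sigma\to F_\sigma$ with $p_{\bar\sigma}\circ\tilde\eta_{\sigma,\bar\sigma}=\eta_{\sigma,\bar\sigma}\circ p_\sigma$, where $\tilde\eta_{\sigma,\bar\sigma}:\tilde F_\sigma\to\tilde F_{\bar\sigma}$ is the inclusion given by (b); (d) the map $H:\mathcal{E}=\bigcup_\sigma P'_\sigma\times\tilde F_\sigma\to\mathfrak{E}(M^{2n},P^k)/T^k$, $H(x,\tilde c)=(x,p_\sigma(\tilde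 c))$, is continuous, where $\mathcal{E}$ has the topology induced by the embedding $\mathcal{E}\to CQ(M^{2n},P^k)\times\mathcal{F}$, $(x,\tilde c)\mapsto(x,I_\sigma(\tilde c))$. *)

(* Defs.v *)
From HB Require Import structures.
From mathcomp Require Import all_boot all_order all_algebra.
From mathcomp Require Import all_classical all_reals all_analysis.
From mathcomp Require Import ring.

Set Implicit Arguments.
Unset Strict Implicit.
Unset Printing Implicit Defensive.

Import Order.TTheory GRing.Theory Num.Theory numFieldNormedType.Exports.
Local Open Scope classical_set_scope.
Local Open Scope ring_scope.
Local Open Scope quotient_scope.

Definition homeomorphism (X Y : topologicalType) (f : X -> Y) : Prop :=
  continuous f /\
  exists g : Y -> X, [/\ continuous g, cancel f g & cancel g f].

(* [Y] with the quotient topology of [f : X -> Y] *)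
Definition final_topology (X : topologicalType) (Y : choiceType)
  (f : X -> Y) : Type := Y.

Section FinalTopology.
Variables (X : topologicalType) (Y : choiceType) (f : X -> Y).

Definition final_open (U : set (final_topology f)) := open (f @^-1` U).

Let final_openT : final_open setT.
Proof. by rewrite /final_open preimage_setT; exact: openT. Qed.

Let final_openI (A B : set (final_topology f)) :
  final_open A -> final_open B -> final_open (A `&` B).
Proof. by rewrite /final_open preimage_setI; exact: openI. Qed.

Let final_open_bigU (I : Type) (A : I -> set (final_topology f)) :
  (forall i, final_open (A i)) -> final_open (\bigcup_i A i).
Proof. by move=> oA; apply: bigcup_open => i _; exact: oA. Qed.

HB.instance Definition _ := Choice.on (final_topology f).
HB.instance Definition _ := isOpenTopological.Build (final_topology f)
  final_openT final_openI final_open_bigU.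

End FinalTopology.

Section Convexity.
Variables (R : realType) (k : nat).
Implicit Types (S : set 'rV[R]_k) (x : 'rV[R]_k).

Definition conv_hull (m : nat) (v : 'I_m -> 'rV[R]_k) (s : {set 'I_m}) :
    set 'rV[R]_k :=
  [set x | exists a : 'I_m -> R,
    [/\ forall i, 0 <= a i, \sum_(i in s) a i = 1 &
        x = \sum_(i in s) a i *: v i]].

Definition convex_polytope S : Prop :=
  exists (N : nat) (v : 'I_N -> 'rV[R]_k), S = conv_hull v [set: 'I_N]%SET.

Definition aff_hull S : set 'rV[R]_k :=
  [set x | exists (N : nat) (p : 'I_N -> 'rV[R]_k) (a : 'I_N -> R),
    [/\ forall i, S (p i), \sum_i a i = 1 & x = \sum_i a i *: p i]].

Definition relint S : set 'rV[R]_k :=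
  [set x | S x /\ \forall y \near x, aff_hull S y -> S y].

Definition aff_dim S (d : nat) : Prop :=
  exists (x : 'rV[R]_k) (D : 'M[R]_k),
    \rank D = d /\ aff_hull S = [set y | (y - x <= D)%MS].

(* [l = 0] is allowed, so that [S] is a face of itself *)
Definition face S (T : set 'rV[R]_k) : Prop :=
  exists (l : 'cV[R]_k) (b : R),
    (forall x, S x -> (x *m l) 0 0 <= b) /\
    T = S `&` [set x | (x *m l) 0 0 = b].

Definition vertices S : set 'rV[R]_k := [set x | face S [set x]].

End Convexity.

Section Smooth.
Variable R : realType.

Fixpoint Cn (N : nat) (d : nat) (U : set 'rV[R]_d) (f : 'rV[R]_d -> R) : Prop :=
  {in U, continuous f} /\
  if N is N'.+1 then
    forall i : 'I_d, {in U, forall u, derivable f u 'e_i} /\ Cn N' U ('D_'e_i f)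
  else True.

(* only used for open [U] *)
Definition Cinfty (d e : nat) (U : set 'rV[R]_d) (f : 'rV[R]_d -> 'rV[R]_e) :=
  forall (N : nat) (j : 'I_e), Cn N U (fun u => f u 0 j).

(* A homeomorphism [coord] from the open set [dom] onto an open subset of R^d,
   with inverse [param]; both maps are total, with irrelevant values outside. *)
Record chart (X : topologicalType) (d : nat) := Chart {
  dom : set X;
  coord : X -> 'rV[R]_d;
  param : 'rV[R]_d -> X;
  dom_open : open dom;
  codom_open : open (coord @` dom);
  coordK : {in dom, cancel coord param};
  coord_continuous : {in dom, continuous coord};
  param_continuous : {in coord @` dom, continuous param}
}.

Definition transition (X : topologicalType) (d : nat) (c c' : chart X d) :=
  coord c' \o param c.

Definition transition_dom (X : topologicalType) (d : nat) (c c' : chart X d) :=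
  coord c @` (dom c `&` dom c').

Definition compatible (X : topologicalType) (d : nat) (c c' : chart X d) :=
  Cinfty (transition_dom c c') (transition c c') /\
  Cinfty (transition_dom c' c) (transition c' c).

Definition smooth_atlas (X : topologicalType) (d : nat) (A : set (chart X d)) :=
  (forall x : X, exists2 c, A c & dom c x) /\
  (forall c c', A c -> A c' -> compatible c c').

Definition smooth_manifold (X : topologicalType) (d : nat)
    (A : set (chart X d)) :=
  [/\ hausdorff_space X, @second_countable X & smooth_atlas A].

Definition oriented_atlas (X : topologicalType) (d : nat)
    (A : set (chart X d)) :=
  forall c c', A c -> A c' ->
    forall u, transition_dom c c' u -> 0 < \det ('J (transition c c') u).

Definition locally_euclidean (X : topologicalType) (d : nat) :=
  forall x : X, exists c : chart X d, dom c x.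

Section EuclideanChart.
Variable d : nat.

Let im_id : id @` [set: 'rV[R]_d] = setT.
Proof. by rewrite image_id. Qed.

Let eucl_codom_open : open (id @` [set: 'rV[R]_d]).
Proof. by rewrite im_id; exact: openT. Qed.

Let eucl_continuous (D : set 'rV[R]_d) :
  {in D, continuous (id : 'rV[R]_d -> 'rV[R]_d)}.
Proof. by move=> x _; exact: cvg_id. Qed.

Definition eucl_chart : chart 'rV[R]_d d :=
  @Chart _ _ setT id id openT eucl_codom_open (fun x _ => erefl x)
    (@eucl_continuous _) (@eucl_continuous _).

End EuclideanChart.

Definition eucl_atlas (d : nat) : set (chart 'rV[R]_d d) :=
  [set eucl_chart d].

Section ProductChart.
Variables (X Y : topologicalType) (d e : nat).
Variables (c : chart X d) (c' : chart Y e).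

Definition prod_dom : set (X * Y) := dom c `*` dom c'.
Definition prod_coord (p : X * Y) : 'rV[R]_(d + e) :=
  row_mx (coord c p.1) (coord c' p.2).
Definition prod_param (u : 'rV[R]_(d + e)) : X * Y :=
  (param c (lsubmx u), param c' (rsubmx u)).

Let lsub_open (U : set 'rV[R]_d) : open U -> open (@lsubmx R 1 d e @^-1` U).
Proof. by apply: open_comp => u _; exact: continuous_lsubmx. Qed.

Let rsub_open (U : set 'rV[R]_e) : open U -> open (@rsubmx R 1 d e @^-1` U).
Proof. by apply: open_comp => u _; exact: continuous_rsubmx. Qed.

Let prod_dom_open : open prod_dom.
Proof.
rewrite openE => -[x y] [/= cx cy]; exists (dom c, dom c') => //=.
by split; apply: open_nbhs_nbhs; split=> //; exact: dom_open.
Qed.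

Let prod_codomE : prod_coord @` prod_dom =
  (@lsubmx R 1 d e @^-1` (coord c @` dom c)) `&`
  (@rsubmx R 1 d e @^-1` (coord c' @` dom c')).
Proof.
apply/seteqP; split=> [_ [[x y] [/= cx cy] <-]|u [[x cx xu] [y cy yu]]].
  by split; rewrite /prod_coord /preimage /= ?row_mxKl ?row_mxKr;
    [exists x|exists y].
by exists (x, y) => //; rewrite /prod_coord /= xu yu hsubmxK.
Qed.

Let prod_codom_open : open (prod_coord @` prod_dom).
Proof.
rewrite prod_codomE; apply: openI.
  by apply: lsub_open; exact: codom_open.
by apply: rsub_open; exact: codom_open.
Qed.

Let prod_coordK : {in prod_dom, cancel prod_coord prod_param}.
Proof.
move=> [x y]; rewrite inE => -[/= cx cy].
by rewrite /prod_coord /prod_param /= row_mxKl row_mxKr !coordK ?inE.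
Qed.

Let prod_coord_continuous : {in prod_dom, continuous prod_coord}.
Proof.
move=> [x y]; rewrite inE => -[/= cx cy] W [P Pxy PW].
have cvgx : coord c p.1 @[p --> (x, y)] --> coord c x.
  apply: (cvg_comp (@fst X Y) (coord c) (G := nbhs x)); first exact: cvg_fst.
  by apply: coord_continuous; rewrite inE.
have cvgy : coord c' p.2 @[p --> (x, y)] --> coord c' y.
  apply: (cvg_comp (@snd X Y) (coord c') (G := nbhs y)); first exact: cvg_snd.
  by apply: coord_continuous; rewrite inE.
have nearP j : \forall p \near (x, y), P 0 j (prod_coord p 0 j).
  move: (Pxy 0 j); rewrite /prod_coord /=; case: (split_ordP j) => i -> Pi.
    rewrite row_mxEl in Pi.
    have H : (coord c p.1) 0 i @[p --> (x, y)] --> (coord c x) 0 i.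
      apply: (cvg_comp (fun p => coord c p.1) (fun v : 'rV_d => v 0 i) cvgx).
      exact: matrix_normedtype.coord_continuous.
    by near=> p; rewrite row_mxEl; near: p; exact: H.
  rewrite row_mxEr in Pi.
  have H : (coord c' p.2) 0 i @[p --> (x, y)] --> (coord c' y) 0 i.
    apply: (cvg_comp (fun p => coord c' p.2) (fun v : 'rV_e => v 0 i) cvgy).
    exact: matrix_normedtype.coord_continuous.
  by near=> p; rewrite row_mxEr; near: p; exact: H.
apply: filterS (filter_forall _ nearP) => p Pp.
by apply: PW => i j; rewrite (ord1 i).
Unshelve. all: by end_near. Qed.

Let prod_param_continuous : {in prod_coord @` prod_dom, continuous prod_param}.
Proof.
move=> u; rewrite prod_codomE inE => -[/= cu c'u].
have pl : param c (lsubmx v) @[v --> u] --> param c (lsubmx u).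
  apply: (cvg_comp (@lsubmx R 1 d e) (param c) (G := nbhs (lsubmx u))).
    exact: continuous_lsubmx.
  by apply: param_continuous; rewrite inE.
have pr : param c' (rsubmx v) @[v --> u] --> param c' (rsubmx u).
  apply: (cvg_comp (@rsubmx R 1 d e) (param c') (G := nbhs (rsubmx u))).
    exact: continuous_rsubmx.
  by apply: param_continuous; rewrite inE.
exact: cvg_pair pl pr.
Qed.

Definition prod_chart : chart (X * Y)%type (d + e) :=
  Chart prod_dom_open prod_codom_open prod_coordK prod_coord_continuous
    prod_param_continuous.

End ProductChart.

Definition prod_atlas (X Y : topologicalType) (d e : nat)
    (A : set (chart X d)) (B : set (chart Y e)) :
    set (chart (X * Y)%type (d + e)) :=
  [set prod_chart c c' | c in A & c' in B].

Section SmoothMaps.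
Variables (X Y : topologicalType) (d e : nat).
Variables (A : set (chart X d)) (B : set (chart Y e)).

(* only used for open [V] *)
Definition smooth_on_open (V : set X) (f : X -> Y) :=
  {in V, continuous f} /\
  forall c c', A c -> B c' ->
    Cinfty (coord c @` (dom c `&` V `&` f @^-1` dom c'))
           (coord c' \o f \o param c).

(* Smoothness on an arbitrary subset [S]: [f] has local smooth extensions. *)
Definition smooth_map (S : set X) (f : X -> Y) :=
  forall x, S x -> exists (V : set X) (g : X -> Y),
    [/\ open V, V x, smooth_on_open V g & {in S `&` V, f =1 g}].

(* [S] is an embedded submanifold, by slice charts. *)
Definition submanifold (S : set X) :=
  exists2 s : nat, (s <= d)%N &
  forall x, S x -> exists c : chart X d,
    [/\ forall a, A a -> compatible c a, dom c x &
        forall y, dom c y ->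
          (S y <-> forall j : 'I_d, (s <= j)%N -> coord c y 0 j = 0)].

End SmoothMaps.

(* [pi] restricts to a smooth fiber bundle [S -> B]: over a neighbourhood of
   each point of [B], [pi] and [r] are the components of a diffeomorphism onto
   [(B `&` O) x Phi], whose inverse is [s]. *)
Definition smooth_fiber_bundle (X : topologicalType) (d k : nat)
    (A : set (chart X d)) (S : set X) (B : set 'rV[R]_k) (pi : X -> 'rV[R]_k) :=
  [/\ smooth_map A (@eucl_atlas k) S pi,
      forall x, S x -> B (pi x) &
      forall b, B b ->
        exists (O : set 'rV[R]_k) (Phi : topologicalType) (e : nat)
               (APhi : set (chart Phi e))
               (r : X -> Phi) (s : 'rV[R]_k * Phi -> X),
        [/\ open O /\ O b, smooth_manifold APhi,
            smooth_map A APhi (S `&` pi @^-1` O) r,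
            smooth_map (prod_atlas (@eucl_atlas k) APhi) A
              ((B `&` O) `*` setT) s &
            (forall x, S x -> O (pi x) -> s (pi x, r x) = x) /\
            (forall b' y, B b' -> O b' ->
               [/\ S (s (b', y)), pi (s (b', y)) = b' & r (s (b', y)) = y])]].

End Smooth.

Section Torus.
Variable R : realType.

(* S^1 as the unit complex numbers [z.1 + i z.2] *)
Definition circle : Type := [set z : R * R | z.1 ^+ 2 + z.2 ^+ 2 = 1].

HB.instance Definition _ := Topological.on circle.

Definition circ (z : R * R) (Hz : z.1 ^+ 2 + z.2 ^+ 2 = 1) : circle :=
  SigSub (mem_set (Hz : [set z : R * R | z.1 ^+ 2 + z.2 ^+ 2 = 1] z)).

Let circleP (z : circle) : (val z).1 ^+ 2 + (val z).2 ^+ 2 = 1.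
Proof. exact: (set_valP z). Qed.

Let one_subproof : (1 : R) ^+ 2 + (0 : R) ^+ 2 = 1.
Proof. by rewrite expr1n expr0n addr0. Qed.

Let mul_subproof (z w : circle) :
  ((val z).1 * (val w).1 - (val z).2 * (val w).2) ^+ 2 +
  ((val z).1 * (val w).2 + (val z).2 * (val w).1) ^+ 2 = 1.
Proof.
transitivity (((val z).1 ^+ 2 + (val z).2 ^+ 2) *
              ((val w).1 ^+ 2 + (val w).2 ^+ 2)); first by ring.
by rewrite !circleP mulr1.
Qed.

Let inv_subproof (z : circle) : (val z).1 ^+ 2 + (- (val z).2) ^+ 2 = 1.
Proof. by rewrite sqrrN circleP. Qed.

Let exp_subproof (t : R) : cos t ^+ 2 + sin t ^+ 2 = 1.
Proof. exact: cos2Dsin2. Qed.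

Definition circle_one : circle := @circ (1, 0) one_subproof.
Definition circle_mul (z w : circle) : circle :=
  @circ (_, _) (mul_subproof z w).
Definition circle_inv (z : circle) : circle := @circ (_, _) (inv_subproof z).
Definition circle_exp (t : R) : circle := @circ (cos t, sin t) (exp_subproof t).

Let circle_mulA : associative circle_mul.
Proof. by move=> x y z; apply/val_inj; congr pair => /=; ring. Qed.
Let circle_mul1 : left_id circle_one circle_mul.
Proof.
by move=> z; apply/val_inj; case: (z) => -[a b] ?; congr pair => /=; ring.
Qed.
Let circle_1mul : right_id circle_one circle_mul.
Proof.
by move=> z; apply/val_inj; case: (z) => -[a b] ?; congr pair => /=; ring.
Qed.
Let circle_mulV : left_inverse circle_one circle_inv circle_mul.
Proof.
move=> z; apply/val_inj; congr pair => /=; last by ring.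
by rewrite mulNr opprK -!expr2 circleP.
Qed.
Let circle_Vmul : right_inverse circle_one circle_inv circle_mul.
Proof.
move=> z; apply/val_inj; congr pair => /=; last by ring.
by rewrite mulrN opprK -!expr2 circleP.
Qed.

HB.instance Definition _ := isGroup.Build circle circle_mulA circle_mul1
  circle_1mul circle_mulV circle_Vmul.

Definition torus (k : nat) : Type := 'rV[circle]_k.
HB.instance Definition _ k := Topological.on (torus k).

Section TorusGroup.
Variable k : nat.

Definition torus_one : torus k := \row_j (1%g : circle).
Definition torus_mul (s t : torus k) : torus k := \row_j (s 0 j * t 0 j)%g.
Definition torus_inv (s : torus k) : torus k := \row_j (s 0 j)^-1%g.

Let torus_mulA : associative torus_mul.
Proof. by move=> x y z; apply/rowP => j; rewrite !mxE mulgA. Qed.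
Let torus_mul1 : left_id torus_one torus_mul.
Proof. by move=> x; apply/rowP => j; rewrite !mxE mul1g. Qed.
Let torus_1mul : right_id torus_one torus_mul.
Proof. by move=> x; apply/rowP => j; rewrite !mxE mulg1. Qed.
Let torus_mulV : left_inverse torus_one torus_inv torus_mul.
Proof. by move=> x; apply/rowP => j; rewrite !mxE mulVg. Qed.
Let torus_Vmul : right_inverse torus_one torus_inv torus_mul.
Proof. by move=> x; apply/rowP => j; rewrite !mxE mulgV. Qed.

HB.instance Definition _ := isGroup.Build (torus k) torus_mulA torus_mul1
  torus_1mul torus_mulV torus_Vmul.

Definition torus_exp (t : 'rV[R]_k) : torus k := \row_j circle_exp (t 0 j).

End TorusGroup.

Record torus_action (k : nat) (X : Type) := TorusAction {
  act :> torus k -> X -> X;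
  act1 : forall x, act 1%g x = x;
  actM : forall s t x, act (s * t)%g x = act s (act t x)
}.

Section Action.
Variables (k : nat) (X : topologicalType) (a : torus_action k X).

Definition fixed_points : set X := [set x | forall s, a s x = x].

Definition stabilizer (S : set X) : set (torus k) :=
  [set s | forall x, S x -> a s x = x].

Definition effective := forall s, (forall x, a s x = x) -> s = 1%g.

Definition invariant (S : set X) := forall s x, S x -> S (a s x).

Let actK (s : torus k) x : a s^-1%g (a s x) = x.
Proof. by rewrite -actM mulVg act1. Qed.

Definition same_orbit (x y : X) : bool := `[< exists s, a s x = y >].

Let same_orbit_refl : reflexive same_orbit.
Proof. by move=> x; apply/asboolP; exists 1%g; rewrite act1. Qed.
Let same_orbit_sym : symmetric same_orbit.
Proof.
by move=> x y; apply/asboolP/asboolP => -[s <-]; exists s^-1%g; rewrite actK.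
Qed.
Let same_orbit_trans : transitive same_orbit.
Proof.
move=> y x z /asboolP[s <-] /asboolP[t <-]; apply/asboolP.
by exists (t * s)%g; rewrite actM.
Qed.

Canonical same_orbit_equiv :=
  EquivRel same_orbit same_orbit_refl same_orbit_sym same_orbit_trans.

Definition orbit_space := quotient_topology {eq_quot same_orbit}.
HB.instance Definition _ := Topological.on orbit_space.

Definition orb (x : X) : orbit_space := \pi_({eq_quot same_orbit}) x.

(* the quotient of T^k by the stabilizer of the points of [S] *)
Variable S : set X.

Definition same_coset (s t : torus k) : bool :=
  `[< stabilizer S (s^-1 * t)%g >].

Let same_cosetE s t : same_coset s t <-> forall x, S x -> a s x = a t x.
Proof.
split=> [/asboolP st x Sx|st].
  by rewrite -{1}(st x Sx) -actM mulVKg.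
by apply/asboolP => x Sx; rewrite actM -st// actK.
Qed.
Let same_coset_refl : reflexive same_coset.
Proof. by move=> s; apply/same_cosetE. Qed.
Let same_coset_sym : symmetric same_coset.
Proof.
by move=> s t; apply/idP/idP => /same_cosetE st; apply/same_cosetE => x Sx;
  rewrite st.
Qed.
Let same_coset_trans : transitive same_coset.
Proof.
move=> t s u /same_cosetE st /same_cosetE tu; apply/same_cosetE => x Sx.
by rewrite st// tu.
Qed.

Canonical same_coset_equiv :=
  EquivRel same_coset same_coset_refl same_coset_sym same_coset_trans.

Definition torus_quotient := quotient_topology {eq_quot same_coset}.
HB.instance Definition _ := Topological.on torus_quotient.

End Action.

(* [torus_exp] is a local diffeomorphism, so an action T^k x X -> X is smooth
   iff its pullback to R^k x X is. *)
Definition smooth_action (k d : nat) (X : topologicalType)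
    (A : set (chart R X d)) (a : torus_action k X) :=
  smooth_map (prod_atlas (@eucl_atlas R k) A) A setT
    (fun p => a (torus_exp p.1) p.2).

End Torus.

(* The open sets M_i are the domains of the charts [ch i]. *)
Definition stratum (R : realType) (M : topologicalType) (d m : nat)
    (ch : 'I_m -> chart R M d) (s : {set 'I_m}) : set M :=
  [set x | forall i : 'I_m, if i \in s then dom (ch i) x else ~ dom (ch i) x].

Definition admissible (R : realType) (M : topologicalType) (d m : nat)
    (ch : 'I_m -> chart R M d) (s : {set 'I_m}) : Prop :=
  stratum ch s !=set0.

Record moment_space (R : realType) (n k : nat) := MomentSpace {
  mcarrier :> topologicalType;
  smooth_str : set (chart R mcarrier (2 * n)%N);
  theta : torus_action R k mcarrier;
  mu : mcarrier -> 'rV[R]_k;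
  nfix : nat;
  ch : 'I_nfix -> chart R mcarrier (2 * n)%N;
  fixpt : 'I_nfix -> mcarrier;

  k_range : (1 <= k <= n)%N;
  M_manifold : smooth_manifold smooth_str;
  M_oriented : oriented_atlas smooth_str;
  M_compact : compact [set: mcarrier];
  theta_smooth : smooth_action smooth_str theta;
  theta_effective : effective theta;
  stabilizer_connected : forall x, connected (stabilizer theta [set x]);
  mu_smooth : smooth_map smooth_str (@eucl_atlas R k) setT mu;
  mu_invariant : forall s x, mu (theta s x) = mu x;
  mu_polytope : convex_polytope (range mu) /\ aff_dim (range mu) k;
  mu_open : forall U : set mcarrier, open U ->
    exists2 O : set 'rV[R]_k, open O & mu @` U = range mu `&` O;

  ax1_atlas : smooth_atlas (range ch);
  ax1_compatible : forall i c, smooth_str c -> compatible (ch i) c;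
  ax1_invariant : forall i, invariant theta (dom (ch i));
  ax1_dense : forall i, dense (dom (ch i));
  ax1_onto : forall i, coord (ch i) @` dom (ch i) = setT;
  ax1_fixed : forall i, dom (ch i) `&` fixed_points theta = [set fixpt i];
  ax1_zero : forall i, coord (ch i) (fixpt i) = 0;
  ax1_distinct : injective fixpt;

  ax2 : set_bij (fixed_points theta) (vertices (range mu)) mu;

  ax3 : forall s x y, stratum ch s x -> stratum ch s y ->
    stabilizer theta [set x] = stabilizer theta [set y]
}.

Section MomentSpaceTheory.
Variables (R : realType) (n k : nat) (X : moment_space R n k).

Definition M_orbits : topologicalType := orbit_space (theta X).
Definition orbit_proj : X -> M_orbits := @orb R k X (theta X).

Definition muhat (q : M_orbits) : 'rV[R]_k := mu (repr q).

Definition adm (s : {set 'I_(nfix X)}) : Prop := admissible (@ch _ _ _ X) s.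
Definition Wsigma (s : {set 'I_(nfix X)}) : set X := stratum (@ch _ _ _ X) s.

Definition vertex (i : 'I_(nfix X)) : 'rV[R]_k := mu (fixpt i).
Definition adm_polytope (s : {set 'I_(nfix X)}) : set 'rV[R]_k :=
  conv_hull vertex s.

Definition Tsigma (s : {set 'I_(nfix X)}) : topologicalType :=
  torus_quotient (theta X) (Wsigma s).

(* W_sigma / T^sigma = W_sigma / T^k, as a subspace of M / T^k *)
Definition Worb (s : {set 'I_(nfix X)}) : set M_orbits :=
  orbit_proj @` Wsigma s.

(* the leaf over [c], for a trivialization [hs] with fiber [Fs] *)
Definition leaf_of (s : {set 'I_(nfix X)}) (Fs : topologicalType)
    (hs : Worb s -> (relint (adm_polytope s) : Type) * Fs) (c : Fs) : set X :=
  [set y | exists2 q : Worb s, val q = orbit_proj y & (hs q).2 = c].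

End MomentSpaceTheory.

(* [bdry s] is the set of those [t] such that the boundary of each leaf of
   [Wsigma s] contains a leaf of [Wsigma t]; the functions [eta_map s t] are
   meaningful only for such [t].  Fields indexed by non-admissible sets are
   unconstrained and irrelevant.  The base of the bundle in [ax4b] is
   contractible, so that bundle is given by its global trivialization. *)
Record leaf_space (R : realType) (n k : nat) := LeafSpace {
  moment :> moment_space R n k;
  Fsigma : {set 'I_(nfix moment)} -> topologicalType;
  hsigma : forall s, Worb s -> (relint (adm_polytope s) : Type) * Fsigma s;
  bdry : {set 'I_(nfix moment)} -> set {set 'I_(nfix moment)};
  eta_map : forall s t, Fsigma s -> Fsigma t;

  ax4a : forall s, adm s ->
    @mu _ _ _ moment @` Wsigma s = relint (adm_polytope s);
  ax4b : forall s, adm s -> homeomorphism (@hsigma s) /\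
    forall q : Worb s, val (hsigma q).1 = muhat (val q);
  ax4c : forall s, adm s -> exists2 d,
    aff_dim (adm_polytope s) d & locally_euclidean R (@Tsigma _ _ _ moment s) d;

  ax5a : forall s (c : Fsigma s), adm s ->
    submanifold (@smooth_str _ _ _ moment) (leaf_of (@hsigma s) c) /\
    smooth_fiber_bundle (@smooth_str _ _ _ moment) (leaf_of (@hsigma s) c)
      (relint (adm_polytope s)) (@mu _ _ _ moment);
  ax5b_face : forall s t, adm s -> bdry s t ->
    adm t /\ face (adm_polytope s) (adm_polytope t);
  ax5b : forall s (c : Fsigma s), adm s ->
    closure (leaf_of (@hsigma s) c) `\` leaf_of (@hsigma s) c =
    \bigcup_(t in bdry s) leaf_of (@hsigma t) (eta_map t c);
  ax5c : forall s t, adm s -> bdry s t -> continuous (@eta_map s t)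
}.

Section Complex.
Variables (R : realType) (n k : nat) (X : leaf_space R n k).

(* C(M,P): the pairs [(s, x)] with [x] in the relative interior of [P_s] *)
Definition cells : Type :=
  [set p : {set 'I_(nfix X)} * 'rV[R]_k |
    adm p.1 /\ relint (adm_polytope p.1) p.2].
HB.instance Definition _ := Choice.on cells.

Definition cell_index (x : cells) : {set 'I_(nfix X)} := (val x).1.
Definition pihat (x : cells) : 'rV[R]_k := (val x).2.

Definition stratum_index (y : X) : {set 'I_(nfix X)} :=
  finset (fun i => `[< dom (@ch _ _ _ X i) y >]).

Let index_in (y : X) : Wsigma (stratum_index y) y.
Proof. by move=> i; rewrite inE; case: asboolP. Qed.

Let cell_subproof (y : X) :
  adm (stratum_index y) /\ relint (adm_polytope (stratum_index y)) (mu y).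
Proof.
have ady : adm (stratum_index y) by exists y; exact: index_in.
by split=> //; rewrite -ax4a//; exists y => //; exact: index_in.
Qed.

Definition cell_map (y : X) : cells :=
  SigSub (mem_set (cell_subproof y :
    [set p : {set 'I_(nfix X)} * 'rV[R]_k |
      adm p.1 /\ relint (adm_polytope p.1) p.2]
      (stratum_index y, mu y))).

Definition CQ : topologicalType := final_topology cell_map.

Definition Erel : set (CQ * X) :=
  [set p | exists s, [/\ adm s, cell_index p.1 = s, Wsigma s p.2 &
                         pihat p.1 = mu p.2]].

Definition Espace : topologicalType := Erel.

Let act_subproof (t : torus R k) (e : Espace) :
  Erel ((val e).1, theta X t (val e).2).
Proof.
have [s [ads idx We pe]] := set_valP e.
exists s; split=> //; last by rewrite pe mu_invariant.
move=> i; move: (We i); case: ifP => _; first exact: ax1_invariant.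
move=> nd d; apply: nd; rewrite -[(val e).2](act1 (theta X)) -(mulVg t) actM.
exact: ax1_invariant.
Qed.

Definition act_E (t : torus R k) (e : Espace) : Espace :=
  SigSub (mem_set (act_subproof t e)).

Let act_E1 (e : Espace) : act_E 1%g e = e.
Proof. by apply/val_inj; rewrite /= act1; case: (val e). Qed.

Let act_EM s t (e : Espace) : act_E (s * t)%g e = act_E s (act_E t e).
Proof. by apply/val_inj; rewrite /= actM. Qed.

Definition theta_E : torus_action R k Espace := TorusAction act_E1 act_EM.

Definition Eorbits : topologicalType := orbit_space theta_E.
Definition Eproj : Espace -> Eorbits := @orb R k Espace theta_E.

(* [z] is the point written [(x, c)] via [hsigma] *)
Definition Epoint (z : Eorbits) (x : CQ) (c : Fsigma (cell_index x)) : Prop :=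
  exists (e : Espace) (q : Worb (cell_index x)),
    [/\ z = Eproj e, (val e).1 = x, val q = orbit_proj (val e).2 &
        (hsigma q).2 = c].

(* the space of the pairs [(x, c~)], with the topology induced by
   [(x, c~) |-> (x, Isigma c~)] *)
Section Etilde.
Variables (Funiv : topologicalType).
Variables (Ftilde : {set 'I_(nfix X)} -> topologicalType).
Variable Isigma : forall s, Ftilde s -> Funiv.
Arguments Isigma : clear implicits.

Definition Etilde_embedding (w : {x : CQ & Ftilde (cell_index x)}) :
    CQ * Funiv :=
  (tag w, Isigma _ (tagged w)).

Definition Etilde : topologicalType := initial_topology Etilde_embedding.

End Etilde.
End Complex.

Record manifold_2nk (R : realType) (n k : nat) := Manifold2nk {
  leaves :> leaf_space R n k;
  Funiv : topologicalType;
  Ftilde : {set 'I_(nfix leaves)} -> topologicalType;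
  Isigma : forall s, Ftilde s -> Funiv;
  psigma : forall s, Ftilde s -> Fsigma s;

  ax6_inclusion : forall s, adm s ->
    continuous (@Isigma s) /\ injective (@Isigma s);
  ax6a_main :
    Ftilde [set: 'I_(nfix leaves)]%SET = Fsigma [set: 'I_(nfix leaves)]%SET;
  ax6a_compact : compact [set: Funiv];
  ax6a_dense : closure (range (@Isigma [set: 'I_(nfix leaves)]%SET)) = setT;
  ax6b_face : forall s t, adm s -> adm t ->
    face (adm_polytope s) (adm_polytope t) ->
    range (@Isigma s) `<=` range (@Isigma t);
  ax6b_cover : \bigcup_i range (@Isigma [set i]%SET) = setT;
  ax6c_projection : forall s, adm s ->
    continuous (@psigma s) /\ range (@psigma s) = setT;
  (* [Isigma b = Isigma a] says that [b] is the image of [a] under the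
     inclusion of [Ftilde s] into [Ftilde t] given by [ax6b_face]. *)
  ax6c_commute : forall s t (a : Ftilde s) (b : Ftilde t), adm s -> bdry s t ->
    Isigma b = Isigma a -> psigma b = eta_map t (psigma a);
  ax6d : exists2 H : Etilde Isigma -> Eorbits leaves, continuous H &
    forall (x : CQ leaves) (c : Ftilde (cell_index x)),
      Epoint (H (existT _ x c)) (psigma c)
}.

Section Statement.
Variables (R : realType) (n k : nat) (X : manifold_2nk R n k).

Definition pairs_rel : set (CQ X * M_orbits X) :=
  [set z | exists s, [/\ adm s, cell_index z.1 = s, Worb s z.2 &
                         pihat z.1 = muhat z.2]].

Definition Epairs : topologicalType := pairs_rel.

Definition G2hat (z : Epairs) : M_orbits X := (val z).2.

End Statement.

(* Main.v *)
Require Import Defs.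
From mathcomp Require Import all_boot all_order all_algebra.
From mathcomp Require Import all_classical all_reals all_analysis.

(** Both spaces of pairs are graphs.  A point [x] of [P'_s] with
    [pihat x = mu y] and [y] in [W_s] is determined by [y]: it is the image of
    [y] under the map [cell_map : M -> CQ].  So [Espace] is the graph of
    [cell_map], with the coordinates swapped, and [Epairs] is in the same way
    the graph of the map induced by [cell_map] on the orbit space.  The topology
    of [CQ] is the quotient topology of [cell_map], so [cell_map] is
    continuous; it is constant on the orbits, so the induced map is continuous
    too.  The projection from the graph of a continuous function to its source
    is a homeomorphism ([graph_projection_homeomorphism]): for [Epairs] this
    projection is [G2hat].

    For [Espace] it gives an equivariant homeomorphism with [M], hence a
    homeomorphism of the orbit spaces ([orbit_space_homeomorphism]); following
    it by the inverse of [G2hat] identifies the orbit space of [Espace] with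
    [Epairs]. *)

Set Implicit Arguments.
Unset Strict Implicit.
Unset Printing Implicit Defensive.

Local Open Scope classical_set_scope.
Local Open Scope quotient_scope.

Lemma homeomorphism_comp (X Y Z : topologicalType) (f : X -> Y) (g : Y -> Z) :
  homeomorphism f -> homeomorphism g -> homeomorphism (g \o f).
Proof.
move=> [cf [f' [cf' fK f'K]]] [cg [g' [cg' gK g'K]]]; split.
  by move=> x; apply: continuous_comp; [exact: cf|exact: cg].
exists (f' \o g'); split; [|exact: can_comp|exact: can_comp].
by move=> z; apply: continuous_comp; [exact: cg'|exact: cf'].
Qed.

Lemma homeomorphism_inverse (X Y : topologicalType) (f : X -> Y) :
  homeomorphism f -> exists2 g : Y -> X, homeomorphism g & cancel g f.
Proof. by move=> [cf [g [cg fK gK]]]; exists g; last exact: gK; split; [|exists f]. Qed.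

Lemma continuous_to_subtype (X Y : topologicalType) (A : set Y) (g : X -> A) :
  continuous ((fun a : A => val a) \o g) -> continuous g.
Proof.
move=> /continuousP cg; apply/continuousP => _ [B oB <-].
exact: cg.
Qed.

(** The inverse [z |-> (f z, z)] is continuous because [f] is. *)
Lemma graph_projection_homeomorphism (Y Z : topologicalType) (f : Z -> Y)
    (A : set (Y * Z)) :
  continuous f -> (forall p, A p <-> p.1 = f p.2) ->
  homeomorphism (fun a : A => (val a).2).
Proof.
move=> cf Af; have Ag z : A (f z, z) by apply/Af.
split.
  move=> a; apply: (@continuous_comp _ _ _ (fun a : A => val a) snd).
    exact: initial_continuous.
  exact: cvg_snd.
exists (fun z => SigSub (mem_set (Ag z)) : A); split=> //.
  apply: continuous_to_subtype => z.
  by apply: cvg_pair => //=; exact: cf.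
move=> a; apply/val_inj; rewrite [RHS]surjective_pairing; congr pair.
by apply/esym/Af; exact: (set_valP a).
Qed.

Section OrbitSpace.
Variables (R : realType) (k : nat).

Lemma orb_eq (X : topologicalType) (a : torus_action R k X) (x y : X) :
  orb a x = orb a y <-> exists s, a s x = y.
Proof.
split=> [/eqmodP/asboolP //|xy].
by apply/eqmodP/asboolP.
Qed.

Lemma orb_repr (X : topologicalType) (a : torus_action R k X)
    (q : orbit_space a) : orb a (repr q) = q.
Proof. exact: reprK. Qed.

(** The two bijections are equivariant, so they and their inverses descend to
    the orbit spaces. *)
Lemma orbit_space_homeomorphism (X Y : topologicalType)
    (a : torus_action R k X) (b : torus_action R k Y) (h : X -> Y) :
  homeomorphism h -> (forall s x, h (a s x) = b s (h x)) ->
  exists2 psi : orbit_space a -> orbit_space b,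
    homeomorphism psi & forall x, psi (orb a x) = orb b (h x).
Proof.
move=> [ch [g [cg hK gK]]] hE.
have gE s y : g (b s y) = a s (g y) by rewrite -{1}(gK y) -hE hK.
have psiE x : orb b (h (repr (orb a x))) = orb b (h x).
  have /orb_eq[s <-] : orb a x = orb a (repr (orb a x)) by rewrite orb_repr.
  by apply/esym/orb_eq; exists s; rewrite hE.
have psi'E y : orb a (g (repr (orb b y))) = orb a (g y).
  have /orb_eq[s <-] : orb b y = orb b (repr (orb b y)) by rewrite orb_repr.
  by apply/esym/orb_eq; exists s; rewrite gE.
exists (fun q => orb b (h (repr q))) => //; split.
  apply/quotient_continuous.
  have -> : (fun q => orb b (h (repr q))) \o \pi_(orbit_space a) = orb b \o h.
    by apply/funext => x; exact: psiE.
  by move=> x; apply: continuous_comp; [exact: ch|exact: pi_continuous].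
exists (fun q => orb a (g (repr q))); split.
- apply/quotient_continuous.
  have -> : (fun q => orb a (g (repr q))) \o \pi_(orbit_space b) = orb a \o g.
    by apply/funext => y; exact: psi'E.
  by move=> y; apply: continuous_comp; [exact: cg|exact: pi_continuous].
- by move=> q; rewrite psi'E hK orb_repr.
- by move=> q; rewrite psiE gK orb_repr.
Qed.

End OrbitSpace.

Section Graphs.
Variables (R : realType) (n k : nat) (X : leaf_space R n k).

Lemma stratum_indexP (s : {set 'I_(nfix X)}) (y : X) :
  Wsigma s y <-> stratum_index y = s.
Proof.
split=> [Wy|<- i].
  apply/setP => i; rewrite inE; move: (Wy i).
  by case: (i \in s) => [|/asboolPn/negbTE ->//]; move/asboolP.
by rewrite inE; case: asboolP.
Qed.

Lemma stratum_index_act (t : torus R k) (y : X) :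
  stratum_index (theta X t y) = stratum_index y.
Proof.
apply/setP => i; rewrite !inE; apply/asboolP/asboolP => [dty|dy].
  rewrite -[y](act1 (theta X)) -(mulVg t) actM.
  exact: ax1_invariant.
exact: ax1_invariant.
Qed.

Lemma cell_map_act (t : torus R k) (y : X) :
  cell_map (theta X t y) = cell_map y.
Proof. by apply/val_inj; rewrite /= stratum_index_act mu_invariant. Qed.

Lemma cell_map_continuous : continuous (cell_map (X := X) : X -> CQ X).
Proof. by apply/continuousP. Qed.

Lemma eq_cell_map (x : cells X) (y : X) :
  x = cell_map y <->
  cell_index x = stratum_index y /\ pihat x = mu y.
Proof.
split=> [->//|[xi xp]]; apply/val_inj.
by rewrite [LHS]surjective_pairing; congr pair.
Qed.

Lemma ErelE (p : CQ X * X) : Erel p <-> p.1 = cell_map p.2.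
Proof.
split=> [[s [_ xs /stratum_indexP ys xy]]|/eq_cell_map[xs xy]].
  by apply/eq_cell_map; rewrite ys xs.
have Wy : Wsigma (stratum_index p.2) p.2 by apply/stratum_indexP.
by exists (stratum_index p.2); split=> //; exists p.2.
Qed.

Definition orbit_cell_map (q : M_orbits X) : CQ X := cell_map (repr q).

Lemma cell_map_orb (y z : X) :
  orbit_proj y = orbit_proj z -> cell_map y = cell_map z.
Proof. by move=> /orb_eq[t <-]; rewrite cell_map_act. Qed.

Lemma orbit_cell_map_proj (y : X) : orbit_cell_map (orbit_proj y) = cell_map y.
Proof. by apply: cell_map_orb; exact: orb_repr. Qed.

Lemma orbit_cell_map_continuous : continuous orbit_cell_map.
Proof.
apply: repr_comp_continuous; first exact: cell_map_continuous.
by move=> y z /eqP yz; apply/eqP; exact: cell_map_orb.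
Qed.

Lemma Worb_repr (s : {set 'I_(nfix X)}) (q : M_orbits X) :
  Worb s q <-> Wsigma s (repr q).
Proof.
split=> [[y /stratum_indexP Wy yq]|Wq]; last first.
  by exists (repr q) => //; exact: orb_repr.
apply/stratum_indexP; rewrite -Wy.
have /orb_eq[t <-] : orbit_proj y = orbit_proj (repr q).
  by rewrite yq; apply/esym; exact: orb_repr.
by rewrite stratum_index_act.
Qed.

End Graphs.

(** A pair in [pairs_rel] is a pair in [Erel] once its orbit is replaced by a
    representative. *)
Lemma pairs_relE (R : realType) (n k : nat) (X : manifold_2nk R n k)
    (z : CQ X * M_orbits X) :
  pairs_rel z <-> z.1 = orbit_cell_map z.2.
Proof.
rewrite -(ErelE (z.1, repr z.2)).
by split=> -[s [ads zs /Worb_repr Wz zp]]; exists s.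
Qed.

Theorem theorem9p6 (R : realType) (n k : nat) (X : manifold_2nk R n k) :
  (exists2 phi : Eorbits X -> Epairs X, homeomorphism phi &
     forall e : Espace X,
       val (phi (Eproj e)) = ((val e).1, orbit_proj (val e).2)) /\
  homeomorphism (@G2hat R n k X).
Proof.
have G2homeo : homeomorphism (@G2hat R n k X).
  apply: graph_projection_homeomorphism (@pairs_relE R n k X).
  exact: orbit_cell_map_continuous.
split=> //.
have Ehomeo : homeomorphism (fun e : Espace X => (val e).2).
  apply: graph_projection_homeomorphism (@ErelE R n k X).
  exact: cell_map_continuous.
have [psi psi_homeo psiE] := orbit_space_homeomorphism
  (a := theta_E X) (b := theta X) Ehomeo (fun _ _ => erefl).
have [g g_homeo gK] := homeomorphism_inverse G2homeo.
exists (g \o psi); first exact: homeomorphism_comp.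
move=> e; set z := (g \o psi) (Eproj e).
have z2 : (val z).2 = orbit_proj (val e).2.
  by rewrite -[LHS]/(G2hat z) gK psiE.
(* a point of a graph is determined by its second component *)
have z1 : (val z).1 = (val e).1.
  have /pairs_relE -> := set_valP z; have /ErelE -> := set_valP e.
  by rewrite z2 orbit_cell_map_proj.
by rewrite [LHS]surjective_pairing z1 z2.
Qed.
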